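(* Suppose $w\ge2$. Let $Z=y_1\wedge y_2$ with $y_1,y_2\in V$ and $S(y_1,y_2)>0$, and define $B_{w,Z}:SO(V)(\mathbb{R})\to\mathbb{V}_w$ by $B_{w,Z}(g)=A_w(Zg)$. Then $D_wB_{w,Z}\equiv0$.
   Context: $V$ is a real quadratic space of dimension $n+4$, signature $(4,n)$ ($n=8k_0+4$), bilinear form $(\,,)$, with involution $\iota$ giving a positive definite majorant $\|v\|^2=\tfrac12(v,\iota v)$; $SO(V)(\mathbb{R})$ acts on the right of $V$, and on $\wedge^2 V$; $K_V$ is the stabilizer of the majorant. $\mathfrak{so}(V)=\mathfrak{k}\oplus\mathfrak{p}$ is the Cartan decomposition for the involution $y_1\wedge y_2\mapsto\iota y_1\wedge\iota y_2$ (identifying $\mathfrak{so}(V)\simeq\wedge^2V$). $p_K:\wedge^2V\otimes\mathbb{C}\to\mathfrak{sl}_2(\mathbb{C})\simeq\mathrm{Sym}^2(V_2)$, $V_2=\mathbb{C}^2$, is the $K_V$-equivariant projection onto the complexified Lie algebra of the long-root $SU(2)\subseteq K_V$; $\mathbb{V}_w=\mathrm{Sym}^{2w}(V_2)$, a $K_V$-representation via $K_V\to SU(2)/\mu_2$. $A_w(X)=p_K(X)^w/\|p_K(X)\|^{2w+1}$ for $p_K(X)\ne0$, $\|\cdot\|$ the $K_V$-invariant norm from the Cartan involution. As a $K_V$-representation $\mathfrak{p}\otimes\mathbb{C}\simeq V_2\otimes W_J$ for a representation $W_J$ (here $W_J=V_2^{(2)}\otimes(V_-\otimes\mathbb{C})$,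 $V_-$ the $-1$ eigenspace of $\iota$). For smooth $F:SO(V)(\mathbb{R})\to\mathbb{V}_w$ with $F(gk)=k^{-1}F(g)$, let $\{X_\gamma\}$ be a basis of $\mathfrak{p}\otimes\mathbb{C}$ with dual basis $\{X_\gamma^\vee\}$ of $(\mathfrak{p}\otimes\mathbb{C})^\vee\simeq V_2\otimes W_J$, and $X_\gamma F$ the right-regular derivative; $D_wF$ is the image of $\sum_\gamma X_\gamma F\otimes X_\gamma^\vee\in\mathrm{Sym}^{2w}(V_2)\otimes V_2\otimes W_J$ under the contraction $\mathrm{Sym}^{2w}(V_2)\otimes V_2\to\mathrm{Sym}^{2w-1}(V_2)$ (the operator defining quaternionic modular forms of weight $w$). $S(y_1,y_2)=\tfrac12\left(\begin{smallmatrix}(y_1,y_1)&(y_1,y_2)\\(y_1,y_2)&(y_2,y_2)\end{smallmatrix}\right)$. *)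

(* Defs.v *)
From HB Require Import structures.
From mathcomp Require Import all_boot all_order all_algebra.
(* mpoly must be imported before MathComp-Analysis: the other order makes the
   two grammars clash. *)
From mathcomp Require Import mpoly.
From mathcomp Require Import all_classical all_reals all_analysis.
From mathcomp Require Import complex ring.
Set Implicit Arguments.
Unset Strict Implicit.
Unset Printing Implicit Defensive.
Import Order.TTheory GRing.Theory Num.Theory.
Import numFieldNormedType.Exports.
Local Open Scope ring_scope.
Local Open Scope complex_scope.
Local Open Scope classical_set_scope.

Section QuadraticSpace.
Variables (R : realType) (N : nat).
Implicit Types (u v : 'rV[R]_N) (Q iota g W X : 'M[R]_N).

(* The quadratic space is 'rV[R]_N with an arbitrary Gram matrix Q; matrices
   act on it on the right. *)
Definition bil Q u v : R := (u *m Q *m v^T) 0 0.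

Definition SOV Q : set 'M[R]_N :=
  [set g | g *m Q *m g^T = Q /\ \det g = 1].

Definition so Q : set 'M[R]_N := [set X | X *m Q + Q *m X^T = 0].

(* Involutive isometry whose associated form (v, iota v) / 2 is positive
   definite. *)
Definition majorant_involution Q iota : Prop :=
  [/\ iota *m iota = 1%:M, iota *m Q *m iota^T = Q
    & forall v, v != 0 -> 0 < 2^-1 * bil Q v (v *m iota)].

Definition posdefmx m (S : 'M[R]_m) : Prop :=
  forall c : 'rV[R]_m, c != 0 -> 0 < (c *m S *m c^T) 0 0.

Definition Smat Q u v : 'M[R]_2 :=
  2^-1 *: \matrix_(i, j) bil Q (if i == 0 then u else v)
                               (if j == 0 then u else v).

(* wedge^2 V is modelled by the antisymmetric matrices. *)
Definition wedge u v : 'M[R]_N := u^T *m v - v^T *m u.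

(* (u ∧ v) g = ug ∧ vg *)
Definition wact W g : 'M[R]_N := g^T *m W *m g.

(* (a ∧ b, c ∧ d) = (a,c)(b,d) - (a,d)(b,c) *)
Definition wform Q W W' : R := - 2^-1 * \tr (Q *m W *m Q *m W').

Definition wnorm Q iota W : R := Num.sqrt (wform Q W (wact W iota)).

(* The isomorphism wedge^2 V ~ so(V); u ∧ v acts on the right of V by
   x |-> (x,u) v - (x,v) u. *)
Definition so_of Q W : 'M[R]_N := Q *m W.

Definition expm X : 'M[R]_N :=
  limn (series (fun k : nat => (k`!%:R)^-1 *: (X ^+ k : 'M[R]_N))).

End QuadraticSpace.

Definition has_signature (R : realType) (p q : nat) (Q : 'M[R]_(p + q)) : Prop :=
  exists2 P : 'M[R]_(p + q), P \in unitmx &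
    P *m Q *m P^T = block_mx 1%:M 0 0 (- 1%:M).
Arguments has_signature {R} p q Q.

(* The rows of e (resp. f) form an orthonormal basis of the +1 (resp. -1)
   eigenspace V_+ (resp. V_-) of iota. *)
Definition adapted_frame (R : realType) (p q : nat) (Q iota : 'M[R]_(p + q))
    (e : 'M[R]_(p, p + q)) (f : 'M[R]_(q, p + q)) : Prop :=
  [/\ e *m iota = e, f *m iota = - f,
      e *m Q *m e^T = 1%:M & f *m Q *m f^T = - 1%:M].

Section BinaryForms.
Variable R : realType.

(* Sym^d(V_2), V_2 = C^2 with basis 'X_0, 'X_1. *)
Definition symV (d : nat) := dhomog 2 R[i] d.

Definition binmon (d k : nat) : 'X_{1..2} := [multinom [tuple (d - k)%N; k]].

Lemma binmon_homog (d : nat) (k : 'I_d.+1) :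
  ('X_[binmon d k] : {mpoly R[i][2]}) \is d.-homog.
Proof.
rewrite dhomogX /= mdegE 2!big_ord_recl big_ord0 !multinomE !(tnth_nth 0%N) /=.
by rewrite addn0 subnK // -ltnS.
Qed.

Definition symmon (d : nat) (k : 'I_d.+1) : symV d := DHomog (binmon_homog k).

Lemma mderiv_homog (d : nat) (P : symV d) (a : 'I_2) :
  (P : {mpoly R[i][2]})^`M(a) \is d.-1.-homog.
Proof.
apply/dhomogP => m; rewrite mcoeff_msupp mcoeff_deriv => nz.
have /(dhomog_mf (dhomog_is_dhomog P)) : (m + U_(a))%MM \in msupp P.
  rewrite mcoeff_msupp; apply: contra nz => /eqP ->; by rewrite mul0rn.
by rewrite /= mdegD mdeg1 addn1 => <-.
Qed.

Definition symderiv (d : nat) (P : symV d) (a : 'I_2) : symV d.-1 :=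
  DHomog (mderiv_homog P a).

(* P (x) 'X_a |-> contraction for the symplectic form <'X_0, 'X_1> = 1, i.e.
   l_1 ... l_d (x) v |-> \sum_r <l_r, v> \prod_(s != r) l_s. *)
Definition contr (d : nat) (P : symV d) (a : 'I_2) : symV d.-1 :=
  if a == 0 then - symderiv P 1 else symderiv P 0.

Definition mx2 (a b c d : R[i]) : 'M[R[i]]_2 :=
  \matrix_(i, j) if i == 0 then (if j == 0 then a else b)
                 else (if j == 0 then c else d).

Lemma mx2_1 : 1%:M = mx2 1 0 0 1.
Proof. by apply/matrixP => -[[|[|//]] ?] [[|[|//]] ?]; rewrite !mxE. Qed.

Lemma mx2Z x a b c d : x *: mx2 a b c d = mx2 (x * a) (x * b) (x * c) (x * d).
Proof. by apply/matrixP => i j; rewrite !mxE; case: ifP; case: ifP. Qed.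

Lemma mx2N a b c d : - mx2 a b c d = mx2 (- a) (- b) (- c) (- d).
Proof. by apply/matrixP => i j; rewrite !mxE; case: ifP; case: ifP. Qed.

Lemma mx2D a b c d a' b' c' d' :
  mx2 a b c d + mx2 a' b' c' d' = mx2 (a + a') (b + b') (c + c') (d + d').
Proof. by apply/matrixP => i j; rewrite !mxE; case: ifP; case: ifP. Qed.

Lemma mx2M a b c d a' b' c' d' :
  mx2 a b c d *m mx2 a' b' c' d' =
  mx2 (a * a' + b * c') (a * b' + b * d') (c * a' + d * c') (c * b' + d * d').
Proof.
apply/matrixP => i j; rewrite !mxE !big_ord_recl big_ord0 addr0 !mxE /=.
by case: ifP; case: ifP.
Qed.

(* The quaternion units 1, I, J, K = IJ; I, J, K span su(2), and J is also the
   matrix of the symplectic form on V_2. *)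
Definition qunit (i : 'I_4) : 'M[R[i]]_2 :=
  nth 0 [:: 1%:M; mx2 'i%C 0 0 (- 'i%C); mx2 0 1 (-1) 0;
            mx2 0 'i%C 'i%C 0] i.

(* sl_2(C) ~ Sym^2(V_2), through V_2 ~ V_2^vee given by the symplectic form. *)
Definition sym2 (y : 'M[R[i]]_2) : {mpoly R[i][2]} :=
  \sum_(a < 2) \sum_(b < 2) (y *m qunit 2) a b *: ('X_a * 'X_b).

Lemma sym2_homog (y : 'M[R[i]]_2) : sym2 y \is 2.-homog.
Proof.
apply: rpred_sum => a _; apply: rpred_sum => b _; apply: rpredZ.
by apply: (@dhomogM _ _ _ 1 _ 1); rewrite dhomogX /= mdeg1.
Qed.

Definition cderiv (h : R -> R[i]) (t : R) : R[i] :=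
  (@complex.Re R \o h)^`() t +i* (@complex.Im R \o h)^`() t.

Definition cderivable (h : R -> R[i]) (t : R) : Prop :=
  derivable (@complex.Re R \o h) t 1 /\ derivable (@complex.Im R \o h) t 1.

End BinaryForms.

Section RightRegular.
Variables (R : realType) (N d : nat).

(* Functions on SO(V) are given on all matrices; only their values on SO(V)
   matter, as g *m expm (t *: X) stays in SO(V) for g in SO(V), X in so(V). *)
Implicit Type F : 'M[R]_N -> symV R d.

Definition coef_along F (X g : 'M[R]_N) (k : 'I_d.+1) (t : R) : R[i] :=
  (F (g *m expm (t *: X)) : {mpoly R[i][2]})@_(binmon d k).

Definition rderivable F (X g : 'M[R]_N) : Prop :=
  forall k : 'I_d.+1, cderivable (coef_along F X g k) 0.

Definition rderiv F (X g : 'M[R]_N) : symV R d :=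
  \sum_(k < d.+1) cderiv (coef_along F X g k) 0 *: symmon R k.

End RightRegular.

Section Quaternionic.
Variables (R : realType) (n : nat).
Variables (Q iota : 'M[R]_(4 + n)) (e : 'M[R]_(4, 4 + n)) (f : 'M[R]_(n, 4 + n)).
Implicit Types (W g : 'M[R]_(4 + n)) (v : 'rV[R]_(4 + n)).

(* Basis of the Lie algebra of the long-root SU(2): one of the two simple
   ideals of so(V_+) = so(4), the choice being the orientation of e. *)
Definition longroot (a : 'I_3) : 'M[R]_(4 + n) :=
  nth 0 [:: wedge (row 0 e) (row 1 e) + wedge (row 2 e) (row 3 e);
            wedge (row 0 e) (row 2 e) - wedge (row 1 e) (row 3 e);
            wedge (row 0 e) (row 3 e) + wedge (row 1 e) (row 2 e)] a.

(* V -> V_+ (x) C ~ V_2 (x) V_2^(2), with rows indexed by the basis of V_2 and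
   columns by that of V_2^(2); it maps row i e to qunit i. *)
Definition spin v : 'M[R[i]]_2 :=
  \sum_(i < 4) (bil Q v (row i e))%:C *: qunit R i.

(* The left action of X in so(V) is v |-> - v *m X.  So longroot a acts on V_+
   through V_2 only, by the matrix - qunit (lift ord0 a) of sl_2(C). *)
Lemma longroot_spin (a : 'I_3) v : e *m Q *m e^T = 1%:M ->
  spin (- (v *m so_of Q (longroot a))) = - qunit R (lift ord0 a) *m spin v.
Proof.
move=> orth_e.
have bilE i j : bil Q (row i e) (row j e) = (i == j)%:R.
  rewrite [RHS](_ : _ = (e *m Q *m e^T) i j); last by rewrite orth_e mxE.
  by rewrite /bil -row_mul tr_row !mxE; apply: eq_bigr => k _; rewrite !mxE.
have wE i j k : bil Q (v *m so_of Q (wedge (row i e) (row j e))) (row k e)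
    = bil Q v (row i e) * (j == k)%:R - bil Q v (row j e) * (i == k)%:R.
  rewrite -!bilE /bil /so_of /wedge !mulmxBr !mulmxA.
  rewrite [v *m Q *m (row i e)^T]mx11_scalar [v *m Q *m (row j e)^T]mx11_scalar.
  by rewrite !mul_scalar_mx !mulmxBl -!scalemxAl !mxE.
have bilD u1 u2 k :
    bil Q (u1 + u2) (row k e) = bil Q u1 (row k e) + bil Q u2 (row k e).
  by rewrite /bil !mulmxDl mxE.
have bilN u1 k : bil Q (- u1) (row k e) = - bil Q u1 (row k e).
  by rewrite /bil !mulNmx mxE.
have soD W1 W2 : v *m so_of Q (W1 + W2) = v *m so_of Q W1 + v *m so_of Q W2.
  by rewrite /so_of !mulmxDr.
have soN W1 : v *m so_of Q (- W1) = - (v *m so_of Q W1).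
  by rewrite /so_of !mulmxN.
have sum4 (G : 'I_4 -> 'M[R[i]]_2) : \sum_(i < 4) G i = G 0 + G 1 + G 2 + G 3.
  rewrite !big_ord_recr big_ord0 /= add0r.
  by congr (G _ + G _ + G _ + G _); apply/val_inj.
rewrite /spin !sum4.
have actE (k : 'I_4) : bil Q (- (v *m so_of Q (longroot a))) (row k e) =
    nth 0 (nth [::] [:: [:: bil Q v (row 1 e); - bil Q v (row 0 e);
                  bil Q v (row 3 e); - bil Q v (row 2 e)];
              [:: bil Q v (row 2 e); - bil Q v (row 3 e);
                  - bil Q v (row 0 e); bil Q v (row 1 e)];
              [:: bil Q v (row 3 e); bil Q v (row 2 e);
                  - bil Q v (row 1 e); - bil Q v (row 0 e)]] a) k.
  case: a => [[|[|[|//]]] lt_a]; rewrite bilN /longroot /= soD ?soN bilD ?bilN !wE;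
    case: k => [[|[|[|[|//]]]] lt_k]; rewrite -!val_eqE /=; ring.
rewrite !{}actE.
move: (bil Q v (row 0 e)) (bil Q v (row 1 e)) (bil Q v (row 2 e))
  (bil Q v (row 3 e)) => x0 x1 x2 x3.
case: a => [[|[|[|//]]] lt_a]; rewrite /qunit /= mx2_1 !mx2Z ?mx2N !mx2D mx2M.
all: congr (mx2 _ _ _ _); apply/eqP; rewrite eq_complex /=; apply/andP; split; apply/eqP.
all: ring.
Qed.

Definition pK_coord W (a : 'I_3) : R :=
  wform Q W (longroot a) / wform Q (longroot a) (longroot a).

(* p_K(W) as an element of the Lie algebra of the long-root SU(2), inside
   wedge^2 V. *)
Definition pK_lie W : 'M[R]_(4 + n) := \sum_(a < 3) pK_coord W a *: longroot a.

(* p_K(W) as an element of Sym^2(V_2) ~ sl_2(C). *)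
Definition pK W : {mpoly R[i][2]} :=
  \sum_(a < 3) (pK_coord W a)%:C *: sym2 (- qunit R (lift ord0 a)).

Definition pK_norm W : R := wnorm Q iota (pK_lie W).

Lemma Aw_homog (w : nat) W :
  ((pK_norm W ^- (2 * w + 1))%:C *: pK W ^+ w) \is (2 * w).-homog.
Proof.
apply/rpredZ/dhomogMn/rpred_sum => a _; exact/rpredZ/sym2_homog.
Qed.

Definition Aw (w : nat) W : symV R (2 * w) := DHomog (Aw_homog w W).

Definition Bw (w : nat) W g : symV R (2 * w) := Aw w (wact W g).

(* The element e_i ∧ f_j of p, as a matrix of so(V). *)
Definition Xp (i : 'I_4) (j : 'I_n) : 'M[R]_(4 + n) :=
  so_of Q (wedge (row i e) (row j f)).

(* Entry (b, j) is the component of D_w F along x'_b (x) f_j, where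
   (x'_0, x'_1) is the basis of V_2^(2) and x'_b (x) f_j the resulting basis of
   W_J.  The basis (Xp i j) of p satisfies (Xp i j, Xp i j) = -1 and is
   orthogonal, so its dual basis is (- Xp i j), which is
   - \sum_(a, b) qunit i a b 'X_a (x) x'_b (x) f_j in V_2 (x) W_J. *)
Definition Dw (w : nat) (F : 'M[R]_(4 + n) -> symV R (2 * w)) g :
    'M[symV R (2 * w).-1]_(2, n) :=
  \matrix_(b, j) - \sum_(i < 4) \sum_(a < 2)
     qunit R i a b *: contr (rderiv F (Xp i j) g) a.

End Quaternionic.

(* Main.v *)
(** Write [Z g = u ∧ v] and let [x], [y] in [R^4] be the coordinates of the
    projections of [u], [v] to [V_+].  Then [p_K (Z g)] has coordinates
    [c = ½ (p01 + p23, p02 - p13, p03 + p12)], where [p_kl = x_k y_l - x_l y_k],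
    and its norm is [sqrt 2 |c|].  By the Pluecker relation [4 |c|^2] is the sum of
    the [p_kl^2], which is positive because the positive plane spanned by [u] and
    [v] does not meet the negative definite space [V_-].

    Along [e_i ∧ f_j] the [V_+]-part of [Z g] moves in the direction [e_i ∧ z],
    with [z = (v, f_j) u_+ - (u, f_j) v_+] independent of [i].  After the common
    factor [p_K^(w-2) / |p_K|^(2w+3)] is taken out, the vanishing of the
    contraction summed over [i] is a polynomial identity valid for all [c] in
    [R^3] and [z] in [R^4]. *)

Require Import Defs.
From HB Require Import structures.
From mathcomp Require Import all_boot all_order all_algebra.
From mathcomp Require Import mpoly.
From mathcomp Require Import all_classical all_reals all_analysis.
From mathcomp Require Import complex.
From mathcomp Require Import ring lra.
Set Implicit Arguments.
Unset Strict Implicit.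
Unset Printing Implicit Defensive.
Import Order.TTheory GRing.Theory Num.Theory.
Import numFieldNormedType.Exports.
Local Open Scope ring_scope.
Local Open Scope complex_scope.
Local Open Scope classical_set_scope.

(** * The matrix exponential: convergence and derivative at 0 *)

(** The growth bound makes [C] times the exponential series at [M * |K|] a majorant. *)
Lemma cvgn_pseries_inv_fact (R : realType) (a : nat -> R) (C M K : R) :
  0 <= M -> (forall k, `|a k| <= C * M ^+ k) ->
  cvgn (pseries (fun k => (k`!%:R)^-1 * a k) K).
Proof.
move=> M0 aM; apply: normed_cvg.
apply: (@series_le_cvg _ _ (fun k => C * exp_coeff (M * `|K|) k)).
- by move=> k; exact: normr_ge0.
- move=> k; rewrite /exp_coeff /= mulr_ge0 //.
    by have := aM 0%N; rewrite expr0 mulr1; apply: le_trans.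
  by rewrite divr_ge0 // exprn_ge0 // mulr_ge0.
- move=> k; rewrite /exp_coeff /= !normrM normrX normfV normr_nat exprMn.
  have -> : C * (M ^+ k * `|K| ^+ k / k`!%:R) = k`!%:R^-1 * (C * M ^+ k) * `|K| ^+ k.
    ring.
  by rewrite ler_wpM2r ?exprn_ge0 // ler_wpM2l ?invr_ge0.
- exact/is_cvg_seriesZ/is_cvg_series_exp_coeff.
Qed.

(** The sum of the absolute values of all entries of [X] bounds every row sum, so the estimate
    passes from [X ^+ k] to [X ^+ k.+1]. *)
Lemma mxpow_bound (R : realType) (N : nat) (X : 'M[R]_N) :
  exists2 M : R, 0 <= M & forall k i j, `|(X ^+ k : 'M[R]_N) i j| <= M ^+ k.
Proof.
exists (\sum_i \sum_j `|X i j|).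
  by apply: sumr_ge0 => i _; apply: sumr_ge0.
elim=> [|k IH] i j.
  by rewrite !expr0 !mxE; case: (i == j); rewrite ?normr1 ?normr0.
rewrite !exprS mxE (le_trans (ler_norm_sum _ _ _)) //.
have rowle : \sum_j0 `|X i j0| <= \sum_i \sum_j `|X i j|.
  by rewrite [leRHS](bigD1 i) //= lerDl; apply: sumr_ge0 => ? _; apply: sumr_ge0.
apply: (@le_trans _ _ (\sum_j0 `|X i j0| * (\sum_i \sum_j `|X i j|) ^+ k)).
  by apply: ler_sum => l _; rewrite normrM ler_wpM2l.
rewrite -mulr_suml ler_wpM2r // exprn_ge0 //.
by apply: sumr_ge0 => ? _; apply: sumr_ge0.
Qed.

(** Neighbourhoods of a matrix are generated by entrywise ones, and finitely many eventual
    conditions hold jointly. *)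
Lemma cvg_mx_entries (R : realType) (m p : nat) (u : nat -> 'M[R]_(m, p)) (L : 'M[R]_(m, p)) :
  (forall i j, u k i j @[k --> \oo] --> L i j) -> u @ \oo --> L.
Proof.
move=> uL; apply/filter_fromP => P LP.
have : \forall k \near \oo, forall ij, P ij.1 ij.2 (u k ij.1 ij.2).
  by apply: filter_forall => -[a b]; exact: (uL a b _ (LP a b)).
by apply: filterS => k Pk i j; exact: (Pk (i, j)).
Qed.

(** Since [expm] is defined by a limit, identifying it needs uniqueness of limits. *)
Lemma mx_hausdorff (R : realType) (m p : nat) : hausdorff_space 'M[R]_(m, p).
Proof.
move=> A B clAB; apply/matrixP => i j; apply: (@Rhausdorff R) => U V AU BV.
have entry (M : 'M[R]_(m, p)) (T : set R) : nbhs (M i j) T ->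
    nbhs M [set M' : 'M[R]_(m, p) | T (M' i j)].
  move=> MT; exists (fun a b => if (a == i) && (b == j) then T else setT).
    move=> a b; case: ifP => [/andP[/eqP-> /eqP->] //|_]; exact: filterT.
  by move=> M' /(_ i j); rewrite !eqxx.
by have [M [? ?]] := clAB _ _ (entry _ _ AU) (entry _ _ BV); exists (M i j).
Qed.

(** Each entry becomes a scalar power series in [t], to which termwise differentiation applies. *)
Lemma expmE (R : realType) (N : nat) (X : 'M[R]_N) t i j :
  expm (t *: X) i j =
  limn (pseries (fun k => (k`!%:R)^-1 * (X ^+ k : 'M[R]_N) i j) t).
Proof.
have [M M0 XM] := mxpow_bound X.
pose L := \matrix_(a, b)
  limn (pseries (fun k => (k`!%:R)^-1 * (X ^+ k : 'M[R]_N) a b) t).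
suff -> : expm (t *: X) = L by rewrite mxE.
apply: cvg_lim; first exact: mx_hausdorff.
apply: cvg_mx_entries => a b; rewrite mxE.
have := @cvgn_pseries_inv_fact R (fun k => (X ^+ k : 'M[R]_N) a b) 1 M t M0.
have H k : `|(X ^+ k : 'M[R]_N) a b| <= 1 * M ^+ k by rewrite mul1r.
move=> /(_ H); set u := pseries _ _ => cu.
rewrite [U in U @ \oo --> _](_ : _ = u); first exact: cu.
apply/funext => k; rewrite /u /pseries /series /= summxE; apply: eq_bigr => l _.
have -> : (t *: X) ^+ l = t ^+ l *: (X ^+ l) :> 'M[R]_N.
  elim: l => [|l IH]; first by rewrite !expr0 scale1r.
  by rewrite !exprS IH -[LHS]/(_ *m _) -scalemxAl -scalemxAr scalerA.
by rewrite !mxE; ring.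
Qed.

Lemma is_derive_expm (R : realType) (N : nat) (X : 'M[R]_N) i j :
  is_derive (0 : R) (1 : R) (fun t => expm (t *: X) i j) (X i j).
Proof.
have [M M0 XM] := mxpow_bound X.
(* The shift [r] counts formal differentiations: they send the coefficients [c r] to [c r.+1], and
   the entries [a r] still grow at most geometrically. *)
pose a (r k : nat) := (X ^+ (k + r) : 'M[R]_N) i j.
pose c (r k : nat) := (k`!%:R)^-1 * a r k.
have cvc r : cvgn (pseries (c r) 1).
  apply: (@cvgn_pseries_inv_fact R (a r) (M ^+ r) M) => // k.
  by rewrite -exprD addnC XM.
have dc r : pseries_diffs (c r) = c r.+1.
  apply/funext => k; rewrite /pseries_diffs /c /a factS natrM invfM addSnnS.
  by rewrite -mulrA mulVKf // pnatr_eq0.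
have -> : (fun t => expm (t *: X) i j) = (fun t => limn (pseries (c 0%N) t)).
  apply/funext => t; rewrite expmE; congr (limn (pseries _ t)).
  by apply/funext => k; rewrite /c /a addn0.
have -> : X i j = limn (pseries (pseries_diffs (c 0%N)) 0).
  rewrite dc; apply/esym/cvg_lim; first exact: Rhausdorff.
  (* At 0 only the term of index 0 survives; the empty partial sum misses it, so the sequence is
     constant from index 1 on. *)
  apply: (@cvg_near_cst _ _ _ _ _ _); exists 1%N => // -[//|k] _ /=.
  rewrite /pseries /series /= big_nat_recl // big1 ?addr0.
    by rewrite /c /a expr0 expr1 fact0 invr1; ring.
  by move=> l _; rewrite expr0n mulr0.
(* The point 0 lies within radius 1, where the series and its first two formal derivatives
   converge. *)
apply: (@pseries_snd_diffs R (c 0%N) 1); rewrite ?dc //.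
by rewrite normr0 normr1.
Qed.

Lemma expm0 (R : realType) (N : nat) (X : 'M[R]_N) : expm (0 *: X) = 1%:M.
Proof.
apply/matrixP => i j; rewrite expmE; apply: cvg_lim; first exact: Rhausdorff.
apply: (@cvg_near_cst _ _ _ _ _ _); exists 1%N => // -[//|k] _ /=.
rewrite /pseries /series /= big_nat_recl // big1 ?addr0.
  by rewrite !expr0 fact0 invr1 mul1r mulr1.
by move=> l _; rewrite expr0n mulr0.
Qed.

(** * Derivatives of complex-valued and polynomial-valued functions of a real variable *)

Definition is_cderive (R : realType) (h : R -> R[i]) (t : R) (dh : R[i]) : Prop :=
  is_derive t 1 (@complex.Re R \o h) (complex.Re dh) /\
  is_derive t 1 (@complex.Im R \o h) (complex.Im dh).

(** Every coefficient is covered, not only those of one degree, so that the notion is stable under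
    products. *)
Definition is_coefderive (R : realType) (m : nat) (P : R -> {mpoly R[i][m]})
    (t : R) (dP : {mpoly R[i][m]}) : Prop :=
  forall k, is_cderive (fun s => (P s)@_k) t dP@_k.

Section CoefficientwiseDerivatives.
Variables (R : realType) (t : R).

Lemma is_cderive_cderivable (h : R -> R[i]) dh :
  is_cderive h t dh -> cderivable h t /\ cderiv h t = dh.
Proof.
case=> -[h1 e1] [h2 e2]; split; first by [].
by rewrite /cderiv !derive1E e1 e2; case: dh {e1 e2}.
Qed.

Lemma is_cderive_cst (z : R[i]) : is_cderive (cst z) t 0.
Proof. by split; exact: is_derive_cst. Qed.

Lemma is_cderiveD (h1 h2 : R -> R[i]) d1 d2 :
  is_cderive h1 t d1 -> is_cderive h2 t d2 ->
  is_cderive (fun s => h1 s + h2 s) t (d1 + d2).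
Proof.
move=> [r1 i1] [r2 i2]; split.
  rewrite (_ : _ \o _ = (@complex.Re R \o h1) + (@complex.Re R \o h2)).
    by rewrite raddfD; exact: is_deriveD.
  by apply/funext => s; rewrite /= raddfD.
rewrite (_ : _ \o _ = (@complex.Im R \o h1) + (@complex.Im R \o h2)).
  by rewrite raddfD; exact: is_deriveD.
by apply/funext => s; rewrite /= raddfD.
Qed.

Lemma is_cderive_sum (I : Type) (r : seq I) (p : pred I) (h : I -> R -> R[i]) dh :
  (forall i, is_cderive (h i) t (dh i)) ->
  is_cderive (fun s => \sum_(i <- r | p i) h i s) t (\sum_(i <- r | p i) dh i).
Proof.
move=> hd; elim: r => [|a r IH].
  rewrite big_nil (_ : (fun _ => _) = cst 0); first exact: is_cderive_cst.
  by apply/funext => s; rewrite big_nil.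
rewrite big_cons (_ : (fun _ => _) =
  fun s => if p a then h a s + \sum_(i <- r | p i) h i s
           else \sum_(i <- r | p i) h i s).
  by case: (p a) => //; exact: is_cderiveD.
by apply/funext => s; rewrite big_cons.
Qed.

Lemma is_cderiveM (h1 h2 : R -> R[i]) d1 d2 :
  is_cderive h1 t d1 -> is_cderive h2 t d2 ->
  is_cderive (fun s => h1 s * h2 s) t (d1 * h2 t + h1 t * d2).
Proof.
move=> [r1 i1] [r2 i2]; pose re (h : R -> R[i]) := @complex.Re R \o h.
pose im (h : R -> R[i]) := @complex.Im R \o h.
rewrite -/(re h1) in r1; rewrite -/(re h2) in r2.
rewrite -/(im h1) in i1; rewrite -/(im h2) in i2; split.
  rewrite (_ : _ \o _ = re h1 * re h2 - im h1 * im h2).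
    apply: is_derive_eq; rewrite /re /im /= /GRing.scale /=.
    by case: (h1 t) (h2 t) d1 d2 {r1 i1 r2 i2} => [? ?] [? ?] [? ?] [? ?] /=; ring.
  by apply/funext => s; rewrite !fctE /re /im /=; case: (h1 s) => ? ?; case: (h2 s).
rewrite (_ : _ \o _ = re h1 * im h2 + im h1 * re h2).
  apply: is_derive_eq; rewrite /re /im /= /GRing.scale /=.
  by case: (h1 t) (h2 t) d1 d2 {r1 i1 r2 i2} => [? ?] [? ?] [? ?] [? ?] /=; ring.
by apply/funext => s; rewrite !fctE /re /im /=; case: (h1 s) => ? ?; case: (h2 s).
Qed.

Lemma is_cderive_real (h : R -> R) dh :
  is_derive t 1 h dh -> is_cderive (fun s => (h s)%:C) t dh%:C.
Proof. by move=> hd; split => //=; exact: is_derive_cst. Qed.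

Variable m : nat.
Implicit Types P : R -> {mpoly R[i][m]}.

Lemma is_coefderive_cst (p : {mpoly R[i][m]}) : is_coefderive (cst p) t 0.
Proof. by move=> k; rewrite mcoeff0; exact: (is_cderive_cst p@_k). Qed.

Lemma is_coefderiveM P1 P2 d1 d2 :
  is_coefderive P1 t d1 -> is_coefderive P2 t d2 ->
  is_coefderive (fun s => P1 s * P2 s) t (d1 * P2 t + P1 t * d2).
Proof.
move=> D1 D2 k; rewrite mcoeffD !mcoeffM -big_split /=.
(* A coefficient of a product is a convolution over a finite index set independent of [s], so the
   Leibniz rule applies termwise. *)
rewrite (_ : (fun _ => _) = fun s => \sum_(l : 'X_{1..m < (mdeg k).+1, (mdeg k).+1}
    | k == (l.1 + l.2)%MM) (P1 s)@_l.1 * (P2 s)@_l.2).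
  by apply: is_cderive_sum => l; exact: is_cderiveM.
by apply/funext => s; rewrite mcoeffM.
Qed.

Lemma is_coefderiveX P d w :
  is_coefderive P t d ->
  is_coefderive (fun s => P s ^+ w) t (w%:R * P t ^+ w.-1 * d).
Proof.
move=> D; elim: w => [|w IH].
  (* At exponent 0 the truncated [w.-1] is multiplied by [w%:R = 0]. *)
  by rewrite !mul0r; exact: is_coefderive_cst.
rewrite (_ : (fun _ => _) = fun s => P s * P s ^+ w); last first.
  by apply/funext => s; rewrite exprS.
have -> : w.+1%:R * P t ^+ w.+1.-1 * d
    = d * P t ^+ w + P t * (w%:R * P t ^+ w.-1 * d).
  case: w {IH} => [|w] /=; first by rewrite !expr0; ring.
  by rewrite !exprS -!natr1; ring.
exact: is_coefderiveM.
Qed.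

Lemma is_coefderive_scale (h : R -> R) dh P dP :
  is_derive t 1 h dh -> is_coefderive P t dP ->
  is_coefderive (fun s => (h s)%:C *: P s) t (dh%:C *: P t + (h t)%:C *: dP).
Proof.
move=> hd PD k; rewrite mcoeffD !mcoeffZ.
rewrite (_ : (fun _ => _) = fun s => (h s)%:C * (P s)@_k).
  by apply: is_cderiveM => //; exact: is_cderive_real.
by apply/funext => s; rewrite mcoeffZ.
Qed.

Lemma is_coefderive_lincomb (I : finType) (c : I -> R -> R) (dc : I -> R)
    (q : I -> {mpoly R[i][m]}) :
  (forall a, is_derive t 1 (c a) (dc a)) ->
  is_coefderive (fun s => \sum_a (c a s)%:C *: q a) t (\sum_a (dc a)%:C *: q a).
Proof.
move=> cd k; rewrite raddf_sum /=.
rewrite (_ : (fun _ => _) = fun s => \sum_a ((c a s)%:C *: q a)@_k).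
  apply: is_cderive_sum => a.
  have := @is_coefderive_scale _ _ (cst (q a)) 0 (cd a) (is_coefderive_cst _) k.
  by rewrite scaler0 addr0.
by apply/funext => s; rewrite raddf_sum.
Qed.

(** The function is [S] to the power [- k / 2]; the extra factor [S^-1] of its derivative appears as
    two more powers of the square root. *)
Lemma is_derive_sqrt_expV (S : R -> R) dS k : 0 < S t -> is_derive t 1 S dS ->
  is_derive t 1 (fun s => Num.sqrt (S s) ^- k)
    (- (k%:R * 2^-1 * dS) * Num.sqrt (S t) ^- (k + 2)).
Proof.
move=> S0 Sd; have nz : Num.sqrt (S t) != 0 by rewrite gt_eqF // sqrtr_gt0.
have Nd : is_derive t 1 (Num.sqrt \o S) ((2 * Num.sqrt (S t))^-1 * dS).
  by apply: is_derive1_comp; exact: is_derive1_sqrt.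
have Xnz : ((Num.sqrt \o S) ^+ k) t != 0 by rewrite fctE expf_neq0.
rewrite (_ : (fun _ => _) = fun s => (((Num.sqrt \o S) ^+ k) s)^-1).
  apply: is_derive_eq; rewrite /= !fctE /GRing.scale /=.
  case: k {Xnz} => [|k]; first by rewrite !mul0r oppr0 mul0r mulr0.
  rewrite /= addn2 -!natr1 !exprS; field.
  by rewrite nz expf_neq0.
by apply/funext => s; rewrite fctE.
Qed.

(* The norm in the denominator of [A_w] is the square root of twice the sum of
   the squares of the coordinates. *)
Lemma is_coefderive_normalized_power (I : finType) (c : I -> R -> R) (dc : I -> R)
    (q : I -> {mpoly R[i][m]}) (w : nat) :
  (forall a, is_derive t 1 (c a) (dc a)) -> 0 < \sum_a c a t ^+ 2 ->
  let r := Num.sqrt (2 * \sum_a c a t ^+ 2) ^- (2 * w + 3) in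
  let q0 := \sum_a (c a t)%:C *: q a in
  let q1 := \sum_a (dc a)%:C *: q a in
  is_coefderive (fun s => (Num.sqrt (2 * \sum_a c a s ^+ 2) ^- (2 * w + 1))%:C
       *: (\sum_a (c a s)%:C *: q a) ^+ w) t
    (r%:C *: ((2 * \sum_a c a t ^+ 2)%:C *: (w%:R * q0 ^+ w.-1 * q1)
              - (2 * (2 * w + 1)%:R * \sum_a c a t * dc a)%:C *: q0 ^+ w)).
Proof.
move=> cd S0 r q0 q1; set S := 2 * \sum_a c a t ^+ 2.
have Sp : 0 < S by rewrite mulr_gt0.
have nz : Num.sqrt S != 0 by rewrite gt_eqF // sqrtr_gt0.
have sumd (r0 : seq I) : is_derive t 1 (fun s => \sum_(a <- r0) c a s ^+ 2)
    (\sum_(a <- r0) 2 * (c a t * dc a)).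
  elim: r0 => [|a r0 IH].
    rewrite big_nil (_ : (fun _ => _) = cst 0); first exact: is_derive_cst.
    by apply/funext => s; rewrite big_nil.
  rewrite big_cons (_ : (fun _ => _) =
    c a ^+ 2 + (fun s => \sum_(a <- r0) c a s ^+ 2)).
    by apply: is_derive_eq; rewrite /GRing.scale /= expr1; ring.
  by apply/funext => s; rewrite big_cons.
have Sd : is_derive t 1 (fun s => 2 * \sum_a c a s ^+ 2)
    (2 * \sum_a 2 * (c a t * dc a)).
  by apply: is_deriveZ.
have D := is_coefderive_scale
  (@is_derive_sqrt_expV (fun s => 2 * \sum_a c a s ^+ 2) _ (2 * w + 1)%N Sp Sd)
  (is_coefderiveX w (is_coefderive_lincomb q cd)).
rewrite -/S -/q0 -/q1 -addnA -/r in D.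
(* This brings both terms of the derivative to the common exponent [2 * w + 3]. *)
have rS : Num.sqrt S ^- (2 * w + 1) = r * S.
  rewrite /r -/S -{3}(sqr_sqrtr (ltW Sp)) -[3%N]/(1 + 2)%N addnA !exprD.
  by field; rewrite nz expf_neq0.
rewrite scalerBr !scalerA -!rmorphM -rS.
rewrite [X in is_coefderive _ _ X](_ : _ = (- (((2 * w + 1)%:R * 2^-1
    * (2 * \sum_a 2 * (c a t * dc a))) * r))%:C *: q0 ^+ w
    + (Num.sqrt S ^- (2 * w + 1))%:C *: (w%:R * q0 ^+ w.-1 * q1)).
  by rewrite -mulNr; exact: D.
rewrite addrC -scaleNr -rmorphN; congr (_%:C *: _ + _).
by rewrite -mulr_sumr; field.
Qed.

End CoefficientwiseDerivatives.

(** * Binary quadratic forms attached to elements of [sl_2(C)] *)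

Section BinaryFormIdentities.
Variable R : realType.

Lemma sum_ord2 (V : nmodType) (G : 'I_2 -> V) : \sum_(i < 2) G i = G 0 + G 1.
Proof.
rewrite !big_ord_recr big_ord0 /= add0r.
by congr (G _ + G _); apply/val_inj.
Qed.

Lemma sum_ord3 (V : nmodType) (G : 'I_3 -> V) :
  \sum_(i < 3) G i = G 0 + G 1 + G 2.
Proof.
rewrite !big_ord_recr big_ord0 /= add0r.
by congr (G _ + G _ + G _); apply/val_inj.
Qed.

Lemma sum_ord4 (V : nmodType) (G : 'I_4 -> V) :
  \sum_(i < 4) G i = G 0 + G 1 + G 2 + G 3.
Proof.
rewrite !big_ord_recr big_ord0 /= add0r.
by congr (G _ + G _ + G _ + G _); apply/val_inj.
Qed.

(** The form in [Sym^2(V_2)] of the element with coordinates [c] in the basis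
    [- qunit R (lift ord0 a)]; its discriminant is [-4 |c|^2]. *)
Definition qform (c : 'I_3 -> R) : {mpoly R[i][2]} :=
  - 2 * 'i%C%:MP * (c 0)%:C%:MP * 'X_0 * 'X_1
  + (c 1)%:C%:MP * ('X_0 ^+ 2 + 'X_1 ^+ 2)
  + 'i%C%:MP * (c 2)%:C%:MP * ('X_0 ^+ 2 - 'X_1 ^+ 2).

Lemma mpolyC_i2 : ('i%C%:MP : {mpoly R[i][2]}) * 'i%C%:MP = -1.
Proof. by rewrite -mpolyCM -expr2 sqr_i mpolyCN. Qed.

Lemma sym2_mx2 (a b c d : R[i]) : sym2 (mx2 a b c d) =
  - b%:MP * 'X_0 ^+ 2 + (a%:MP - d%:MP) * 'X_0 * 'X_1 + c%:MP * 'X_1 ^+ 2.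
Proof.
rewrite /sym2 (_ : _ *m _ = mx2 (- b) a (- d) c); last first.
  by rewrite mx2M !mulr0 !mulr1 !mulrN1 !add0r !addr0.
by rewrite !sum_ord2 !mxE /= -!mul_mpolyC !mpolyCN; ring.
Qed.

Lemma sum_sym2 (c : 'I_3 -> R) :
  \sum_(a < 3) (c a)%:C *: sym2 (- qunit R (lift ord0 a)) = qform c.
Proof.
rewrite sum_ord3 /qunit /= !mx2N !sym2_mx2 !mpolyCN !opprK mpolyC0 mpolyC1.
by rewrite -!mul_mpolyC /qform; ring.
Qed.

Definition qformX (c : 'I_3 -> R) : {mpoly R[i][2]} :=
  - 2 * 'i%C%:MP * (c 0)%:C%:MP * 'X_1
  + 2 * (c 1)%:C%:MP * 'X_0 + 2 * 'i%C%:MP * (c 2)%:C%:MP * 'X_0.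

Definition qformY (c : 'I_3 -> R) : {mpoly R[i][2]} :=
  - 2 * 'i%C%:MP * (c 0)%:C%:MP * 'X_0
  + 2 * (c 1)%:C%:MP * 'X_1 - 2 * 'i%C%:MP * (c 2)%:C%:MP * 'X_1.

Lemma mderiv_var (a b : 'I_2) : ('X_a : {mpoly R[i][2]})^`M(b) = (a == b)%:R.
Proof.
rewrite mderivX mnm1E; case: eqP => [->|_]; last by rewrite scale0r.
by rewrite scale1r (_ : (_ - _)%MM = 0%MM) ?mpolyX0 //; apply/mnmP => i;
  rewrite mnmBE mnm0E subnn.
Qed.

Lemma mderiv_nat (k : nat) a : (k%:R : {mpoly R[i][2]})^`M(a) = 0.
Proof. by rewrite -mpolyC_nat mderivC. Qed.

Lemma mderiv_exp (p : {mpoly R[i][2]}) k a :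
  (p ^+ k)^`M(a) = k%:R * p ^+ k.-1 * p^`M(a).
Proof.
elim: k => [|k IH]; first by rewrite !mul0r; exact: (mderiv_nat 1).
rewrite exprS mderivM IH; case: k {IH} => [|k] /=; first by rewrite !expr0; ring.
by rewrite !exprS -!natr1; ring.
Qed.

Lemma mderiv_qform0 c : (qform c)^`M(0) = qformX c.
Proof.
rewrite /qform /qformX !(mderivD, mderivN, mderivM) !mderiv_var.
by rewrite !mderivC !eqxx /=; ring.
Qed.

Lemma mderiv_qform1 c : (qform c)^`M(1) = qformY c.
Proof.
rewrite /qform /qformY !(mderivD, mderivN, mderivM) !mderiv_var.
by rewrite !mderivC !eqxx /=; ring.
Qed.

End BinaryFormIdentities.

(** * Vanishing of the contraction as a polynomial identity *)

Section ContractionIdentity.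
Variable R : realType.

(* Coordinates, in the basis [longroot], of the projection of a bivector with
   Pluecker coordinates [p k l] on [e_k ∧ e_l]. *)
Definition sd_coord (p : 'I_4 -> 'I_4 -> R) (a : 'I_3) : R :=
  nth 0 [:: p 0 1 + p 2 3; p 0 2 - p 1 3; p 0 3 + p 1 2] a / 2.

(* Up to a positive factor, the derivative of [A_w] at [c] in direction [d]. *)
Definition dAw (w : nat) (c d : 'I_3 -> R) : {mpoly R[i][2]} :=
  (2 * \sum_a c a ^+ 2)%:C *: (w%:R * qform c ^+ w.-1 * qform d)
  - (2 * (2 * w + 1)%:R * \sum_a c a * d a)%:C *: qform c ^+ w.

(** A partial derivative of [dAw w c d] without its factor [w q^(w-2)]: here [v = w - 2], [q] and
    [p] are the forms of [c] and [d], [dq] and [dp] their derivatives, [S] and [T] the scalar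
    coefficients. The abstract ring keeps the identity below within reach of [ring]. *)
Definition bracket (A : comNzRingType) (v S T q dq p dp : A) : A :=
  S * ((v + 1) * dq * p + q * dp) - T * q * dq.

Lemma mderiv_dAw v c d a : (dAw v.+2 c d)^`M(a) =
  v.+2%:R * qform c ^+ v *
   bracket v%:R (2 * \sum_a c a ^+ 2)%:C%:MP
    (2 * (2 * v.+2 + 1)%:R * \sum_a c a * d a)%:C%:MP
    (qform c) (qform c)^`M(a) (qform d) (qform d)^`M(a).
Proof.
rewrite /dAw /bracket /=; move: (_%:C) (_%:C) (qform c) (qform d) => A B p q.
rewrite mderivB !mderivZ mderiv_exp mderivM mderivM mderiv_exp mderiv_nat.
rewrite -!mul_mpolyC /= !exprS; move: (p ^+ v) => E.
by ring.
Qed.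

(** The four triples are the coordinates of [e_i ∧ z], with [h] in place of 1/2. The weights are
    entries of [qunit i], one column for each conclusion, and [2 * v + 5] is [2 * w + 1]. *)
Lemma bracket_contraction (A : comNzRingType) (I X Y h v c0 c1 c2 z0 z1 z2 z3 : A) :
  I * I = -1 ->
  let q a0 a1 a2 := - 2 * I * a0 * X * Y + a1 * (X ^+ 2 + Y ^+ 2)
                    + I * a2 * (X ^+ 2 - Y ^+ 2) in
  let qX a0 a1 a2 := - 2 * I * a0 * Y + 2 * a1 * X + 2 * I * a2 * X in
  let qY a0 a1 a2 := - 2 * I * a0 * X + 2 * a1 * Y - 2 * I * a2 * Y in
  let S := 2 * (c0 ^+ 2 + c1 ^+ 2 + c2 ^+ 2) in
  let T a0 a1 a2 := 2 * (2 * v + 5) * (c0 * a0 + c1 * a1 + c2 * a2) in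
  let bX a0 a1 a2 := bracket v S (T a0 a1 a2) (q c0 c1 c2) (qX c0 c1 c2)
    (q a0 a1 a2) (qX a0 a1 a2) in
  let bY a0 a1 a2 := bracket v S (T a0 a1 a2) (q c0 c1 c2) (qY c0 c1 c2)
    (q a0 a1 a2) (qY a0 a1 a2) in
  - bY (z1 * h) (z2 * h) (z3 * h) - I * bY (- z0 * h) (- z3 * h) (z2 * h)
    - bX (z3 * h) (- z0 * h) (- z1 * h) + I * bX (- z2 * h) (z1 * h) (- z0 * h) = 0
  /\
  bX (z1 * h) (z2 * h) (z3 * h) - I * bX (- z0 * h) (- z3 * h) (z2 * h)
    - bY (z3 * h) (- z0 * h) (- z1 * h) - I * bY (- z2 * h) (z1 * h) (- z0 * h) = 0.
Proof.
by move=> I2 q qX qY S T bX bY; rewrite /bX /bY /bracket /q /qX /qY /S /T; split; ring: I2.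
Qed.

(** All terms share the factor [w q^(w-2)]; the cofactors sum to one of the two combinations in
    [bracket_contraction], according to [b]. *)
Lemma contraction_dAw (c : 'I_3 -> R) (z : 'I_4 -> R) (w : nat) (b : 'I_2) :
  let d (i : 'I_4) :=
    sd_coord (fun k l => (k == i)%:R * z l - (l == i)%:R * z k) in
  (2 <= w)%N ->
  \sum_(i < 4) (qunit R i 1 b *: (dAw w c (d i))^`M(0)
                - qunit R i 0 b *: (dAw w c (d i))^`M(1)) = 0.
Proof.
case: w => [|[|v]] // d _.
pose K (x : R) : {mpoly R[i][2]} := x%:C%:MP.
pose q a0 a1 a2 : {mpoly R[i][2]} := - 2 * 'i%C%:MP * a0 * 'X_0 * 'X_1
  + a1 * ('X_0 ^+ 2 + 'X_1 ^+ 2) + 'i%C%:MP * a2 * ('X_0 ^+ 2 - 'X_1 ^+ 2).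
pose qX a0 a1 a2 : {mpoly R[i][2]} :=
  - 2 * 'i%C%:MP * a0 * 'X_1 + 2 * a1 * 'X_0 + 2 * 'i%C%:MP * a2 * 'X_0.
pose qY a0 a1 a2 : {mpoly R[i][2]} :=
  - 2 * 'i%C%:MP * a0 * 'X_0 + 2 * a1 * 'X_1 - 2 * 'i%C%:MP * a2 * 'X_1.
pose S := 2 * (K (c 0) ^+ 2 + K (c 1) ^+ 2 + K (c 2) ^+ 2).
pose T a0 a1 a2 := 2 * (2 * v%:R + 5) * (K (c 0) * a0 + K (c 1) * a1 + K (c 2) * a2).
pose bX a0 a1 a2 := bracket v%:R S (T a0 a1 a2) (q (K (c 0)) (K (c 1)) (K (c 2)))
  (qX (K (c 0)) (K (c 1)) (K (c 2))) (q a0 a1 a2) (qX a0 a1 a2).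
pose bY a0 a1 a2 := bracket v%:R S (T a0 a1 a2) (q (K (c 0)) (K (c 1)) (K (c 2)))
  (qY (K (c 0)) (K (c 1)) (K (c 2))) (q a0 a1 a2) (qY a0 a1 a2).
have KD : {morph K : x y / x + y} by move=> x y; rewrite /K !rmorphD.
have KM : {morph K : x y / x * y} by move=> x y; rewrite /K !rmorphM.
have KN : {morph K : x / - x} by move=> x; rewrite /K !rmorphN.
have Kn k : K k%:R = k%:R by rewrite /K !rmorph_nat.
have KX x k : K (x ^+ k) = K x ^+ k by rewrite /K !rmorphXn.
have SE : (2 * \sum_a c a ^+ 2)%:C%:MP = S.
  by rewrite -/(K _) KM (Kn 2) sum_ord3 !KD !KX.
have TE i : (2 * (2 * v.+2 + 1)%:R * \sum_a c a * d i a)%:C%:MP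
    = T (K (d i 0)) (K (d i 1)) (K (d i 2)).
  rewrite -/(K _) KM KM (Kn 2) (Kn (2 * v.+2 + 1)%N) sum_ord3 !KD !KM /T.
  by rewrite natrD natrM -!natr1; ring.
pose E := v.+2%:R * qform c ^+ v.
have term i : qunit R i 1 b *: (dAw v.+2 c (d i))^`M(0)
      - qunit R i 0 b *: (dAw v.+2 c (d i))^`M(1)
    = E * ((qunit R i 1 b)%:MP * bX (K (d i 0)) (K (d i 1)) (K (d i 2))
           - (qunit R i 0 b)%:MP * bY (K (d i 0)) (K (d i 1)) (K (d i 2))).
  rewrite mderiv_dAw [in X in _ - _ *: X]mderiv_dAw -/E SE (TE i).
  rewrite !mderiv_qform0 !mderiv_qform1 -!mul_mpolyC /bX /bY.
  rewrite -[qform c]/(q _ _ _) -[qform (d i)]/(q _ _ _).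
  rewrite -[qformX c]/(qX _ _ _) -[qformX (d i)]/(qX _ _ _).
  rewrite -[qformY c]/(qY _ _ _) -[qformY (d i)]/(qY _ _ _).
  by move: (bracket _ _ _ _ _ _ _) (bracket _ _ _ _ _ _ _) E; move=> *; ring.
rewrite (eq_bigr _ (fun i _ => term i)) -mulr_sumr.
have : - bY (K (z 1) * K 2^-1) (K (z 2) * K 2^-1) (K (z 3) * K 2^-1)
    - 'i%C%:MP * bY (- K (z 0) * K 2^-1) (- K (z 3) * K 2^-1) (K (z 2) * K 2^-1)
    - bX (K (z 3) * K 2^-1) (- K (z 0) * K 2^-1) (- K (z 1) * K 2^-1)
    + 'i%C%:MP * bX (- K (z 2) * K 2^-1) (K (z 1) * K 2^-1) (- K (z 0) * K 2^-1) = 0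
  /\ bX (K (z 1) * K 2^-1) (K (z 2) * K 2^-1) (K (z 3) * K 2^-1)
    - 'i%C%:MP * bX (- K (z 0) * K 2^-1) (- K (z 3) * K 2^-1) (K (z 2) * K 2^-1)
    - bY (K (z 3) * K 2^-1) (- K (z 0) * K 2^-1) (- K (z 1) * K 2^-1)
    - 'i%C%:MP * bY (- K (z 2) * K 2^-1) (K (z 1) * K 2^-1) (- K (z 0) * K 2^-1) = 0.
  exact: bracket_contraction (@mpolyC_i2 R).
move=> [H0 H1].
suff -> : \sum_(i < 4) ((qunit R i 1 b)%:MP * bX (K (d i 0)) (K (d i 1)) (K (d i 2))
     - (qunit R i 0 b)%:MP * bY (K (d i 0)) (K (d i 1)) (K (d i 2))) = 0.
  by rewrite mulr0.
rewrite sum_ord4.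
have dE i a : K (d i a) = nth 0 (nth [::] [::
    [:: K (z 1) * K 2^-1; K (z 2) * K 2^-1; K (z 3) * K 2^-1];
    [:: - K (z 0) * K 2^-1; - K (z 3) * K 2^-1; K (z 2) * K 2^-1];
    [:: K (z 3) * K 2^-1; - K (z 0) * K 2^-1; - K (z 1) * K 2^-1];
    [:: - K (z 2) * K 2^-1; K (z 1) * K 2^-1; - K (z 0) * K 2^-1]] i) a.
  by case: i => [[|[|[|[|//]]]] lt_i]; case: a => [[|[|[|//]]] lt_a];
    rewrite /d /sd_coord -!val_eqE /= -?KN -KM; congr K; ring.
(* With the brackets opaque, [ring] only compares linear combinations of them. *)
rewrite !dE /=; clear SE TE term dE; clearbody bX bY.
case: b => [[|[|//]] lt_b]; [rewrite -[RHS]H0 | rewrite -[RHS]H1].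
  by rewrite /qunit /= mx2_1 !mxE /= !mpolyCN mpolyC0 mpolyC1; ring.
by rewrite /qunit /= mx2_1 !mxE /= !mpolyCN mpolyC0 mpolyC1; ring.
Qed.

End ContractionIdentity.

(** * The bilinear form, bivectors and their inner product *)

Section Bivectors.
Variables (R : realType) (N : nat) (Q : 'M[R]_N).
Implicit Types (u v : 'rV[R]_N) (W g : 'M[R]_N).

Lemma bilDl u1 u2 v : bil Q (u1 + u2) v = bil Q u1 v + bil Q u2 v.
Proof. by rewrite /bil !mulmxDl mxE. Qed.

Lemma bilNl u v : bil Q (- u) v = - bil Q u v.
Proof. by rewrite /bil !mulNmx mxE. Qed.

Lemma bilZl a u v : bil Q (a *: u) v = a * bil Q u v.
Proof. by rewrite /bil -!scalemxAl mxE. Qed.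

Lemma bilDr u v1 v2 : bil Q u (v1 + v2) = bil Q u v1 + bil Q u v2.
Proof. by rewrite /bil linearD mulmxDr mxE. Qed.

Lemma bilZr a u v : bil Q u (a *: v) = a * bil Q u v.
Proof. by rewrite /bil linearZ -scalemxAr mxE. Qed.

Lemma bilC u v : Q^T = Q -> bil Q u v = bil Q v u.
Proof.
by move=> QT; rewrite /bil -[in RHS]QT -[v in RHS]trmxK -!trmx_mul mulmxA [RHS]mxE.
Qed.

Lemma bil_row m (A : 'M[R]_(m, N)) u k : bil Q u (row k A) = (u *m Q *m A^T) 0 k.
Proof. by rewrite /bil tr_row mxE [RHS]mxE; apply: eq_bigr => l _; rewrite [col _ _ _ _]mxE. Qed.

Lemma bil_rows m p (A : 'M[R]_(m, N)) (B : 'M[R]_(p, N)) i j :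
  bil Q (row i A) (row j B) = (A *m Q *m B^T) i j.
Proof. by rewrite bil_row -!row_mul [LHS]mxE. Qed.

Lemma bil_isometry g u v : g *m Q *m g^T = Q ->
  bil Q (u *m g) (v *m g) = bil Q u v.
Proof.
by move=> gQ; rewrite /bil trmx_mul -!mulmxA (mulmxA g) (mulmxA (g *m _)) gQ !mulmxA.
Qed.

Lemma wact_wedge u v g : wact (wedge u v) g = wedge (u *m g) (v *m g).
Proof. by rewrite /wact /wedge !trmx_mul mulmxBr mulmxBl !mulmxA. Qed.

Lemma wactD W1 W2 g : wact (W1 + W2) g = wact W1 g + wact W2 g.
Proof. by rewrite /wact mulmxDr mulmxDl. Qed.

Lemma wactN W g : wact (- W) g = - wact W g.
Proof. by rewrite /wact mulmxN mulNmx. Qed.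

Lemma wactZ a W g : wact (a *: W) g = a *: wact W g.
Proof. by rewrite /wact -scalemxAr -scalemxAl. Qed.

Lemma wformDl W1 W2 W : wform Q (W1 + W2) W = wform Q W1 W + wform Q W2 W.
Proof. by rewrite /wform mulmxDr !mulmxDl linearD mulrDr. Qed.

Lemma wformNl W1 W : wform Q (- W1) W = - wform Q W1 W.
Proof. by rewrite /wform mulmxN !mulNmx linearN mulrN. Qed.

Lemma wformZl a W1 W : wform Q (a *: W1) W = a * wform Q W1 W.
Proof. by rewrite /wform -scalemxAr -!scalemxAl linearZ mulrCA. Qed.

Lemma wformDr W W1 W2 : wform Q W (W1 + W2) = wform Q W W1 + wform Q W W2.
Proof. by rewrite /wform mulmxDr linearD mulrDr. Qed.

Lemma wformNr W W1 : wform Q W (- W1) = - wform Q W W1.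
Proof. by rewrite /wform mulmxN linearN mulrN. Qed.

Lemma wformZr a W W1 : wform Q W (a *: W1) = a * wform Q W W1.
Proof. by rewrite /wform -scalemxAr linearZ mulrCA. Qed.

(** Expanding gives four traces of products of rank-one matrices; by cyclicity each splits into two
    values of the form. *)
Lemma wform_wedge a b c d : Q^T = Q ->
  wform Q (wedge a b) (wedge c d) = bil Q a c * bil Q b d - bil Q a d * bil Q b c.
Proof.
move=> QT.
have T x y z t : \tr (Q *m (x^T *m y) *m Q *m (z^T *m t)) = bil Q t x * bil Q y z.
  have -> : Q *m (x^T *m y) *m Q *m (z^T *m t)
      = Q *m x^T *m (y *m Q *m z^T) *m t by rewrite !mulmxA.
  rewrite [y *m Q *m z^T]mx11_scalar mul_mx_scalar -scalemxAl linearZ /=.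
  by rewrite mxtrace_mulC mulmxA trace_mx11 mulrC.
rewrite /wform /wedge !(mulmxBr, mulmxBl) !linearB /= !T.
rewrite (bilC d a) // (bilC c a) // (bilC d b) // (bilC c b) //.
by field.
Qed.

Lemma mul_so_wedge u a b :
  u *m so_of Q (wedge a b) = bil Q u a *: b - bil Q u b *: a.
Proof.
rewrite /so_of /wedge !mulmxBr !mulmxA /bil.
by rewrite [u *m Q *m a^T]mx11_scalar [u *m Q *m b^T]mx11_scalar !mul_scalar_mx !mxE.
Qed.

(** [Smat] is half the Gram matrix of [u], [v], so its positivity is that of the form on the plane
    they span. *)
Lemma posdef_Smat u v s t : posdefmx (Smat Q u v) -> (s, t) != (0, 0) ->
  0 < bil Q (s *: u + t *: v) (s *: u + t *: v).
Proof.
move=> Sp st; pose c : 'rV[R]_2 := \row_i if i == 0 then s else t.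
have cnz : c != 0.
  apply: contra st => /eqP/matrixP c0; have := c0 0 0; have := c0 0 1.
  by rewrite !mxE /= => -> ->.
have := Sp c cnz; rewrite /Smat -scalemxAr -scalemxAl mxE pmulr_rgt0 ?invr_gt0 //.
rewrite !mxE !sum_ord2 !mxE !sum_ord2 !mxE /=; congr (0 < _).
by rewrite !bilDl !bilDr !bilZl !bilZr; ring.
Qed.

End Bivectors.

(** * Splitting along the frame, and the projection to the long-root algebra *)

Section Frame.
Variables (R : realType) (n : nat) (Q iota : 'M[R]_(4 + n)).
Variables (e : 'M[R]_(4, 4 + n)) (f : 'M[R]_(n, 4 + n)).
Hypotheses (QT : Q^T = Q) (hiota : majorant_involution Q iota)
  (hef : adapted_frame Q iota e f).

Lemma frame_ee i j : bil Q (row i e) (row j e) = (i == j)%:R.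
Proof. by have [_ _ ee _] := hef; rewrite bil_rows ee mxE. Qed.

(** The isometry [iota] acts by opposite signs on the two eigenspaces, so each product equals its
    own negative. *)
Lemma frame_ef_mx : e *m Q *m f^T = 0.
Proof.
have [ei fi _ _] := hef; have [_ iQ _] := hiota.
have : (e *m iota) *m Q *m (f *m iota)^T = e *m Q *m f^T.
  by rewrite trmx_mul -[in RHS]iQ !mulmxA.
rewrite ei fi linearN mulmxN => H.
by apply/matrixP => i j; have /matrixP/(_ i j) := H; rewrite !mxE; lra.
Qed.

Lemma frame_fe i j : bil Q (row j f) (row i e) = 0.
Proof. by rewrite bilC // bil_rows frame_ef_mx mxE. Qed.

(** The stacked frame [M] has Gram matrix [J] with [J *m J = 1], which yields a resolution of the
    identity to insert next to [Q]. *)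
Lemma bil_frame (r : 'rV[R]_(4 + n)) :
  bil Q r r = \sum_k bil Q r (row k e) ^+ 2 - \sum_j bil Q r (row j f) ^+ 2.
Proof.
have [ei fi ee ff] := hef.
pose M := col_mx e f; pose J : 'M[R]_(4 + n) := block_mx 1%:M 0 0 (- 1%:M).
have MQ : M *m Q *m M^T = J.
  rewrite /M tr_col_mx mul_col_mx mul_col_row frame_ef_mx ee ff; congr block_mx.
  by apply: trmx_inj; rewrite trmx0 !trmx_mul trmxK QT mulmxA frame_ef_mx.
have JJ : J *m J = 1%:M.
  rewrite /J mulmx_block !mul0mx !mulmx0 !mul1mx !addr0 add0r.
  by rewrite mulNmx mulmxN opprK mul1mx -scalar_mx_block.
have inv : Q *m M^T *m J *m M = 1%:M.
  by apply: mulmx1C; rewrite !mulmxA MQ JJ.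
have -> : bil Q r r = ((r *m Q *m M^T) *m J *m (r *m Q *m M^T)^T) 0 0.
  rewrite /bil !trmx_mul trmxK QT -[in LHS](mul1mx Q) -inv.
  by rewrite !mulmxA.
rewrite /M tr_col_mx mul_mx_row /J mul_row_block !mulmx0 mulmx1 addr0 add0r.
rewrite mulmxN mulmx1 tr_row_mx mul_row_col mulNmx mxE [X in _ + X]mxE.
by congr (_ - _); rewrite mxE; apply: eq_bigr => k _;
  rewrite bil_row [_^T _ _]mxE expr2.
Qed.

Let plucker (u v : 'rV[R]_(4 + n)) (k l : 'I_4) : R :=
  bil Q u (row k e) * bil Q v (row l e) - bil Q u (row l e) * bil Q v (row k e).

(** The bivectors [e_i ∧ e_j], [i < j], are orthonormal, and the three basis elements use disjoint
    pairs of them. *)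
Lemma wform_longroot a b : wform Q (longroot e a) (longroot e b) = 2 * (a == b)%:R.
Proof.
rewrite /longroot; pose om (i j : 'I_4) := wedge (row i e) (row j e).
have omE i j k l : wform Q (om i j) (om k l)
    = (i == k)%:R * (j == l)%:R - (i == l)%:R * (j == k)%:R.
  by rewrite wform_wedge // !frame_ee.
rewrite -!/(om _ _); clearbody om.
by case: a => [[|[|[|//]]] lt_a]; case: b => [[|[|[|//]]] lt_b];
  rewrite /= !(wformDl, wformDr, wformNl, wformNr) !omE -!val_eqE /=; ring.
Qed.

(** The square norm 2 of [longroot] is the denominator in [sd_coord]. *)
Lemma pK_coord_wedge u v a : pK_coord Q e (wedge u v) a = sd_coord (plucker u v) a.
Proof.
rewrite /pK_coord wform_longroot eqxx mulr1 /sd_coord /longroot.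
pose om (i j : 'I_4) := wedge (row i e) (row j e); rewrite -!/(om _ _).
have omE k l : wform Q (wedge u v) (om k l) = plucker u v k l.
  exact: wform_wedge.
clearbody om; move: (wedge u v) omE => W omE.
by case: a => [[|[|[|//]]] lt_a] /=; rewrite !(wformDr, wformNr) !omE.
Qed.

Lemma wact_longroot a : wact (longroot e a) iota = longroot e a.
Proof.
rewrite /longroot; pose om (i j : 'I_4) := wedge (row i e) (row j e).
have omE i j : wact (om i j) iota = om i j.
  by have [ei _ _ _] := hef; rewrite wact_wedge -!row_mul ei.
rewrite -!/(om _ _); clearbody om.
by case: a => [[|[|[|//]]] lt_a] /=; rewrite wactD ?wactN !omE.
Qed.

(** As [iota] fixes the long-root algebra, the majorant norm there comes from [wform], for which the
    basis is orthogonal of square norm 2. *)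
Lemma pK_normE W : pK_norm Q iota e W = Num.sqrt (2 * \sum_a pK_coord Q e W a ^+ 2).
Proof.
rewrite /pK_norm /wnorm /pK_lie !sum_ord3 !wactD !wactZ !wact_longroot.
move: (longroot e) wform_longroot => L LE.
rewrite !(wformDl, wformDr, wformZl, wformZr) !LE; congr Num.sqrt.
by rewrite -!val_eqE /=; ring.
Qed.

Lemma sd_coord_wedge_eq0 (x y : 'I_4 -> R) :
  \sum_a sd_coord (fun k l => x k * y l - x l * y k) a ^+ 2 = 0 ->
  forall k l, x k * y l = x l * y k.
Proof.
(* The Pluecker relation kills the cross terms of the sum of squares. *)
have -> : \sum_a sd_coord (fun k l => x k * y l - x l * y k) a ^+ 2 =
    8^-1 * \sum_k \sum_l (x k * y l - x l * y k) ^+ 2.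
  (* The double sum counts each square twice, and the 1/2 of [sd_coord] is squared: hence [8^-1]. *)
  by rewrite sum_ord3 !sum_ord4 /sd_coord /=; field.
move=> /eqP; rewrite mulf_eq0 invr_eq0 pnatr_eq0 /= => /eqP s0 k l.
have sq_ge0 k' : 0 <= \sum_l' (x k' * y l' - x l' * y k') ^+ 2.
  by apply: sumr_ge0 => ? _; exact: sqr_ge0.
have := psumr_eq0P (fun k' _ => sq_ge0 k') s0 (i := k) isT.
move=> /(psumr_eq0P (fun _ _ => sqr_ge0 _)) /(_ l isT) /eqP.
by rewrite sqrf_eq0 subr_eq0 => /eqP.
Qed.

(* If the projection to [V_+] of the positive plane spanned by [u] and [v] were
   degenerate, the plane would meet [V_-]. *)
Lemma pK_coord_gt0 u v :
  (forall s t, (s, t) != (0, 0) -> 0 < bil Q (s *: u + t *: v) (s *: u + t *: v)) ->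
  0 < \sum_a pK_coord Q e (wedge u v) a ^+ 2.
Proof.
move=> pos; rewrite lt_def sumr_ge0 ?andbT => [|a _]; last exact: sqr_ge0.
apply/negP => /eqP s0.
have dep k l : bil Q u (row k e) * bil Q v (row l e)
    = bil Q u (row l e) * bil Q v (row k e).
  apply: (@sd_coord_wedge_eq0 (fun k => bil Q u (row k e))
    (fun k => bil Q v (row k e))).
  by rewrite -[RHS]s0; apply: eq_bigr => a _; rewrite pK_coord_wedge.
(* A nonzero pair giving a combination orthogonal to [V_+]: [u] itself if its projection vanishes,
   otherwise [v_k u - u_k v] for some [u_k != 0]. *)
have [s [t [st perp]]] : exists s t, (s, t) != (0, 0) /\
    forall k, s * bil Q u (row k e) + t * bil Q v (row k e) = 0.
  have [u0|[k uk]] : (forall k, bil Q u (row k e) = 0) \/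
      exists k, bil Q u (row k e) != 0.
    have [/forallP u0|/existsP[k uk]] :=
      boolP [forall k, bil Q u (row k e) == 0].
      by left => k; exact/eqP.
    by right; exists k.
  - exists 1, 0; split=> [|k]; first by rewrite xpair_eqE oner_eq0.
    by rewrite u0 mulr0 mul0r addr0.
  - exists (bil Q v (row k e)), (- bil Q u (row k e)); split=> [|l].
      by rewrite xpair_eqE oppr_eq0 negb_and uk orbT.
    by rewrite mulNr (dep k l); ring.
(* On that combination the form is minus a sum of squares, against positivity. *)
have := pos s t st; apply/negP; rewrite -leNgt bil_frame big1 ?sub0r.
  by rewrite oppr_le0 sumr_ge0 // => j _; exact: sqr_ge0.
by move=> k _; rewrite bilDl !bilZl perp expr0n.
Qed.

End Frame.

(** * Uniqueness of derivatives; the form along one-parameter subgroups *)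

Lemma is_cderive_unique (R : realType) (h : R -> R[i]) t d1 d2 :
  is_cderive h t d1 -> is_cderive h t d2 -> d1 = d2.
Proof.
by move=> /is_cderive_cderivable[_ <-] /is_cderive_cderivable[_ <-].
Qed.

Lemma is_derive_bigsum (R : realType) m (h : 'I_m -> R -> R) dh (t : R) :
  (forall i, is_derive t 1 (h i) (dh i)) ->
  is_derive t 1 (fun s => \sum_i h i s) (\sum_i dh i).
Proof. by move=> hd; rewrite -fct_sumE; exact: is_derive_sum. Qed.

(** The value is a fixed linear combination of the entries of the exponential. *)
Lemma is_derive_bil_expm (R : realType) N (Q X : 'M[R]_N) (u v : 'rV[R]_N) :
  is_derive (0 : R) 1 (fun t => bil Q (u *m expm (t *: X)) v) (bil Q (u *m X) v).
Proof.
have E (A : 'M[R]_N) :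
    bil Q (u *m A) v = \sum_k \sum_i (u 0 i * (Q *m v^T) k 0) * A i k.
  rewrite /bil -mulmxA mxE; apply: eq_bigr => k _; rewrite mxE mulr_suml.
  by apply: eq_bigr => i _; ring.
rewrite E; under eq_fun do rewrite E.
apply: is_derive_bigsum => k; apply: is_derive_bigsum => i.
by have := is_derive_expm X i k => D; exact: is_deriveZ.
Qed.

(** * Homogeneous binary forms and right-regular derivatives *)

Section HomogeneousForms.
Variable R : realType.

Lemma binmon_mdeg d (k : 'I_d.+1) : mdeg (binmon d k) = d.
Proof.
have := binmon_homog R k; rewrite dhomogX /=; exact/eqP.
Qed.

Lemma binmon_inj d : injective (fun k : 'I_d.+1 => binmon d k).
Proof.
move=> k l /mnmP/(_ 1); rewrite !multinomE !(tnth_nth 0%N) /= => kl.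
exact: val_inj.
Qed.

Lemma mdeg_binmon d (m : 'X_{1..2}) : mdeg m = d ->
  exists k : 'I_d.+1, m = binmon d k.
Proof.
rewrite mdegE sum_ord2 => md.
have lt_m : (m 1%R < d.+1)%N by rewrite ltnS -md leq_addl.
exists (Ordinal lt_m); apply/mnmP => i.
rewrite multinomE (tnth_nth 0%N) /=.
case: i => [[|[|//]] lt_i] /=.
  rewrite -md addnK; congr (m _); exact: val_inj.
congr (m _); exact: val_inj.
Qed.

Lemma dhomog_binmonE d (P : {mpoly R[i][2]}) : P \is d.-homog ->
  P = \sum_(k < d.+1) P@_(binmon d k) *: 'X_[binmon d k].
Proof.
move=> Ph; apply/mpolyP => m; rewrite raddf_sum /=.
have [md|md] := eqVneq (mdeg m) d.
  have [k ->] := mdeg_binmon md.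
  rewrite (bigD1 k) //= mcoeffZ mcoeffX eqxx mulr1 big1 ?addr0 // => l lk.
  rewrite mcoeffZ mcoeffX (_ : _ == _ = false) ?mulr0 //.
  by apply: contraNF lk => /eqP/binmon_inj->.
rewrite (dhomog_nemf_coeff Ph) // big1 // => k _.
rewrite mcoeffZ mcoeffX (_ : _ == _ = false) ?mulr0 //.
by apply: contraNF md => /eqP <-; rewrite binmon_mdeg.
Qed.

(** [rderiv] only collects coefficients in degree [d]. The others vanish identically along the
    curve, so [dP] is homogeneous and nothing is lost. *)
Lemma rderivE N d (F : 'M[R]_N -> symV R d) (X g : 'M[R]_N) dP :
  is_coefderive (fun t => F (g *m expm (t *: X)) : {mpoly R[i][2]}) 0 dP ->
  rderivable F X g /\ (rderiv F X g : {mpoly R[i][2]}) = dP.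
Proof.
move=> D; have coefD (k : 'I_d.+1) := is_cderive_cderivable (D (binmon d k)).
split; first by move=> k; have [] := coefD k.
have dPh : dP \is d.-homog.
  apply/dhomogP => m; rewrite mcoeff_msupp; apply: contraNeq => md.
  apply/eqP; apply: is_cderive_unique (D m) _.
  rewrite (_ : (fun _ => _) = cst 0); first exact: is_cderive_cst.
  apply/funext => s; rewrite (dhomog_nemf_coeff (dhomog_is_dhomog _)) //.
rewrite [RHS](dhomog_binmonE dPh) /rderiv raddf_sum /=; apply: eq_bigr => k _.
by have [_ <-] := coefD k.
Qed.

Lemma qform_neq0 (c : 'I_3 -> R) : 0 < \sum_a c a ^+ 2 -> qform c <> 0.
Proof.
rewrite sum_ord3 => cp q0.
have ev (x y : R[i]) : - 2 * 'i%C * (c 0)%:C * x * y + (c 1)%:C * (x ^+ 2 + y ^+ 2)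
    + 'i%C * (c 2)%:C * (x ^+ 2 - y ^+ 2) = 0.
  pose s (k : 'I_2) := if k == 0 then x else y.
  have := congr1 (meval s) q0; rewrite meval0 /qform.
  rewrite !(rmorphD, rmorphB, rmorphM, rmorphN, rmorphXn, rmorph_nat) /=.
  by rewrite !mevalC !mevalXU.
(* The values are [c1 + i c2] at [(1, 0)] and [2 c1 - 2 i c0] at [(1, 1)]. *)
have := ev 1 0; have := ev 1 1.
rewrite !(expr1n, expr0n, subrr, subr0, addr0, mulr0, mulr1, add0r) /=.
move=> /eqP; rewrite eq_complex /= => /andP[/eqP a1 /eqP a2].
move=> /eqP; rewrite eq_complex /= => /andP[/eqP a3 /eqP a4].
have c0 : c 0 = 0 by lra.
have c1 : c 1 = 0 by lra.
have c2 : c 2 = 0 by lra.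
by move: cp; rewrite c0 c1 c2 !expr0n !addr0 ltxx.
Qed.

End HomogeneousForms.

(** * Symmetry of [Q], and the derivative of [Bw] along one-parameter subgroups *)

Lemma signature_sym (R : realType) p q (Q : 'M[R]_(p + q)) :
  has_signature p q Q -> Q^T = Q.
Proof.
case=> P Pu PQ; have PTu : P^T \in unitmx by rewrite unitmx_tr.
apply: (can_inj (mulKmx Pu)); apply: (can_inj (mulmxK PTu)).
have -> : P *m Q^T *m P^T = (P *m Q *m P^T)^T by rewrite !trmx_mul trmxK mulmxA.
by rewrite PQ tr_block_mx !trmx0 linearN /= !trmx1.
Qed.

Lemma is_derive_sd_coord (R : realType) (p : 'I_4 -> 'I_4 -> R -> R) dp (t : R) a :
  (forall k l, is_derive t 1 (p k l) (dp k l)) ->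
  is_derive t 1 (fun s => sd_coord (fun k l => p k l s) a) (sd_coord dp a).
Proof.
move=> pd; pose r : R := 2^-1; rewrite /sd_coord -/r.
case: a => [[|[|[|//]]] lt_a] /=.
- rewrite (_ : (fun _ => _) = (p 0 1 + p 2 3) * cst r) //.
  by apply: is_derive_eq; rewrite /GRing.scale /=; ring.
- rewrite (_ : (fun _ => _) = (p 0 2 - p 1 3) * cst r) //.
  by apply: is_derive_eq; rewrite /GRing.scale /=; ring.
- rewrite (_ : (fun _ => _) = (p 0 3 + p 1 2) * cst r) //.
  by apply: is_derive_eq; rewrite /GRing.scale /=; ring.
Qed.

Lemma is_coefderive_Aw_curve (R : realType) (c : 'I_3 -> R -> R) dc (t : R) w :
  (forall a, is_derive t 1 (c a) (dc a)) -> 0 < \sum_a c a t ^+ 2 ->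
  is_coefderive (fun s => (Num.sqrt (2 * \sum_a c a s ^+ 2) ^- (2 * w + 1))%:C
      *: (\sum_a (c a s)%:C *: sym2 (- qunit R (lift ord0 a))) ^+ w) t
    ((Num.sqrt (2 * \sum_a c a t ^+ 2) ^- (2 * w + 3))%:C *: dAw w (c^~ t) dc).
Proof.
move=> cd cp.
have := is_coefderive_normalized_power (fun a => sym2 (- qunit R (lift ord0 a))) w cd cp.
by cbv zeta; rewrite (sum_sym2 (c^~ t)) (sum_sym2 dc).
Qed.

Section Derivatives.
Variables (R : realType) (n : nat) (Q iota : 'M[R]_(4 + n)).
Variables (e : 'M[R]_(4, 4 + n)) (f : 'M[R]_(n, 4 + n)).
Hypotheses (QT : Q^T = Q) (hiota : majorant_involution Q iota)
  (hef : adapted_frame Q iota e f).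
Variables (w : nat) (y1 y2 : 'rV[R]_(4 + n)) (g : 'M[R]_(4 + n)).
Let u := y1 *m g.
Let v := y2 *m g.
Let x k := bil Q u (row k e).
Let y k := bil Q v (row k e).
Let c := sd_coord (fun k l => x k * y l - x l * y k).
Hypothesis c_gt0 : 0 < \sum_a c a ^+ 2.

Let dc (X : 'M[R]_(4 + n)) (a : 'I_3) : R :=
  sd_coord (fun k l => bil Q (u *m X) (row k e) * y l + x k * bil Q (v *m X) (row l e)
    - (bil Q (u *m X) (row l e) * y k + x l * bil Q (v *m X) (row k e))) a.

Let ct (X : 'M[R]_(4 + n)) (a : 'I_3) (t : R) : R :=
  pK_coord Q e (wact (wedge y1 y2) (g *m expm (t *: X))) a.

Lemma ctE X a t : ct X a t = sd_coord (fun k l =>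
    bil Q (u *m expm (t *: X)) (row k e) * bil Q (v *m expm (t *: X)) (row l e)
  - bil Q (u *m expm (t *: X)) (row l e) * bil Q (v *m expm (t *: X)) (row k e)) a.
Proof. by rewrite /ct wact_wedge !mulmxA (pK_coord_wedge QT hef). Qed.

Lemma ct0 X a : ct X a 0 = c a.
Proof. by rewrite ctE expm0 !mulmx1. Qed.

Lemma is_derive_ct X a : is_derive (0 : R) 1 (ct X a) (dc X a).
Proof.
pose xt k t := bil Q (u *m expm (t *: X)) (row k e).
pose yt k t := bil Q (v *m expm (t *: X)) (row k e).
have xd k : is_derive (0 : R) 1 (xt k) (bil Q (u *m X) (row k e)).
  exact: is_derive_bil_expm.
have yd k : is_derive (0 : R) 1 (yt k) (bil Q (v *m X) (row k e)).
  exact: is_derive_bil_expm.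
have xt0 k : xt k 0 = x k by rewrite /xt expm0 mulmx1.
have yt0 k : yt k 0 = y k by rewrite /yt expm0 mulmx1.
pose p k l := xt k * yt l - xt l * yt k.
pose dp k l := bil Q (u *m X) (row k e) * y l + x k * bil Q (v *m X) (row l e)
    - (bil Q (u *m X) (row l e) * y k + x l * bil Q (v *m X) (row k e)).
have pd k l : is_derive (0 : R) 1 (p k l) (dp k l).
  by apply: is_derive_eq; rewrite /dp !xt0 !yt0 /GRing.scale /=; ring.
rewrite (_ : ct X a = fun t => sd_coord (fun k l => p k l t) a).
  exact: is_derive_sd_coord.
by apply/funext => t; exact: ctE.
Qed.

(** [Bw] depends on the bivector only through its three long-root coordinates, whose velocity at 0
    is [dc X]. *)
Lemma is_coefderive_Bw X : is_coefderive
  (fun t => Bw Q iota e w (wedge y1 y2) (g *m expm (t *: X)) : {mpoly R[i][2]}) 0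
  ((Num.sqrt (2 * \sum_a c a ^+ 2) ^- (2 * w + 3))%:C *: dAw w c (dc X)).
Proof.
have cE : (fun a => ct X a 0) = c by apply/funext => a; exact: ct0.
have ctp : 0 < \sum_a ct X a 0 ^+ 2 by under eq_bigr do rewrite ct0.
have D := is_coefderive_Aw_curve w (is_derive_ct X) ctp.
rewrite cE in D; rewrite (_ : (fun _ => _) = fun t =>
  (Num.sqrt (2 * \sum_a ct X a t ^+ 2) ^- (2 * w + 1))%:C
  *: (\sum_a (ct X a t)%:C *: sym2 (- qunit R (lift ord0 a))) ^+ w).
  have -> : \sum_a c a ^+ 2 = \sum_a ct X a 0 ^+ 2.
    by apply: eq_bigr => a _; rewrite ct0.
  exact: D.
by apply/funext => t; rewrite /Bw /Aw /= (pK_normE QT hef).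
Qed.

(** [Xp] sends [u] to [(u, e_i) f_j - (u, f_j) e_i]; the first term is orthogonal to [V_+], so only
    motion along [e_i] is seen. *)
Lemma dc_Xp i j : dc (Xp Q e f i j) =
  sd_coord (fun k l => (k == i)%:R * (bil Q v (row j f) * x l - bil Q u (row j f) * y l)
    - (l == i)%:R * (bil Q v (row j f) * x k - bil Q u (row j f) * y k)).
Proof.
apply/funext => a; congr sd_coord; apply/funext => k; apply/funext => l.
rewrite !mul_so_wedge !bilDl !bilNl !bilZl !(frame_fe QT hiota hef) !(frame_ee hef).
by rewrite (eq_sym i k) (eq_sym i l) /x /y; ring.
Qed.

End Derivatives.

(** * Positivity, differentiability and the contraction identity combined *)

Theorem theorem3p5 (R : realType) (k0 n : nat) (hn : n = (8 * k0 + 4)%N)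
  (Q iota : 'M[R]_(4 + n)) (e : 'M[R]_(4, 4 + n)) (f : 'M[R]_(n, 4 + n))
  (hQ : has_signature 4 n Q) (hiota : majorant_involution Q iota)
  (hef : adapted_frame Q iota e f)
  (w : nat) (hw : (2 <= w)%N) (y1 y2 : 'rV[R]_(4 + n))
  (hS : posdefmx (Smat Q y1 y2)) :
  let Z := wedge y1 y2 in
  let B := Bw Q iota e w Z in
  forall g : 'M[R]_(4 + n), SOV Q g ->
    [/\ pK Q e (wact Z g) <> 0,
        forall X : 'M[R]_(4 + n), so Q X -> rderivable B X g
      & Dw Q e f B g = 0].
Proof.
move=> Z B g [gQ _]; have QT := signature_sym hQ.
(* The isometry [g] carries the positive plane of [y1], [y2] to a positive plane. *)
have pos : 0 < \sum_a pK_coord Q e (wedge (y1 *m g) (y2 *m g)) a ^+ 2.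
  apply: (pK_coord_gt0 QT hiota hef) => s t st.
  by rewrite !scalemxAl -!mulmxDl bil_isometry //; exact: posdef_Smat.
pose x k := bil Q (y1 *m g) (row k e); pose y k := bil Q (y2 *m g) (row k e).
pose c := sd_coord (fun k l => x k * y l - x l * y k).
have c_gt0 : 0 < \sum_a c a ^+ 2.
  rewrite (eq_bigr (fun a => pK_coord Q e (wedge (y1 *m g) (y2 *m g)) a ^+ 2)) //.
  by move=> a _; rewrite (pK_coord_wedge QT hef).
split.
- by rewrite /pK sum_sym2 wact_wedge; exact: qform_neq0.
(* Differentiability ensures that the derivatives in [Dw] are not default values. *)
- by move=> X _; have [] := rderivE (is_coefderive_Bw QT hef w c_gt0 X).
apply/matrixP => b j; rewrite [LHS]mxE [RHS]mxE; apply: val_inj.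
pose z l := bil Q (y2 *m g) (row j f) * x l - bil Q (y1 *m g) (row j f) * y l.
pose d (i : 'I_4) := sd_coord (fun k l => (k == i)%:R * z l - (l == i)%:R * z k).
pose r := (Num.sqrt (2 * \sum_a c a ^+ 2) ^- (2 * w + 3))%:C.
have dB i : (rderiv B (Xp Q e f i j) g : {mpoly R[i][2]}) = r *: dAw w c (d i).
  have [_ ->] := rderivE (is_coefderive_Bw QT hef w c_gt0 (Xp Q e f i j)).
  by rewrite (dc_Xp QT hiota hef).
(* Contracting with ['X_0] is minus the derivative in ['X_1], and with ['X_1] the derivative in
   ['X_0]; the scalar [r] does not depend on [i]. *)
transitivity (- (r *: \sum_(i < 4) (qunit R i 1 b *: (dAw w c (d i))^`M(0)
                - qunit R i 0 b *: (dAw w c (d i))^`M(1)))); last first.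
  by rewrite (contraction_dAw c z b hw) scaler0 oppr0.
rewrite [LHS]linearN /=; congr (- _); rewrite raddf_sum scaler_sumr /=.
apply: eq_bigr => i _; rewrite sum_ord2 raddfD /= dB !mderivZ.
by rewrite scalerN scalerBr !scalerA [r * _]mulrC [r * qunit _ _ _ _]mulrC addrC.
Qed.
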